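(* For every integer $k\geq 1$, every $\delta>0$, every $\epsilon>0$ and every function $\sigma\colon\mathbb{N}\to(0,1)$ there is an integer $N=N(k,\delta,\epsilon,\sigma)$ such that the following holds. Let $V$ and $W$ be finite nonempty sets and let $f\colon V\times W\to[0,1]$ be a $(k,\delta)$-stable function. Then there are partitions $V=V_0\cup V_1\cup\ldots\cup V_m$ and $W=W_0\cup W_1\cup\ldots\cup W_n$ with $m,n\leq N$ such that: (1) for all $(i,j)\in[m]\times[n]$, the pair $(V_i,W_j)$ is $(5\delta+\epsilon;\sigma(mn))$-homogeneous (with respect to $f$ and the normalized counting measures on $V$ and $W$); (2) $|V_0|\leq\epsilon|V_1|$ and $|W_0|\leq\epsilon|W_1|$.
   Context: $[n]=\{1,\ldots,n\}$. For reals $r,s$ and $\epsilon>0$, $r\approx_\epsilon s$ means $|r-s|\leq\epsilon$. A function $f\colon V\times W\to\mathbb{R}$ is $(k,\delta)$-stable if there do not exist $a_1,\ldots,a_k\in V$ and $b_1,\ldots,b_k\in W$ with $|f(a_i,b_j)-f(a_j,b_i)|\geq\delta$ for all $1\leq i<j\leq k$. Homogeneity: let $f\colon V\times W\to[0,1]$, and let $\mu,\nu$ be finitely additive probability measures on Boolean algebras $\mathcal{A},\mathcal{B}$ of subsets of $V,W$ (here: all subsets, with $\mu(X)=|X|/|V|$, $\nu(Y)=|Y|/|W|$). For $\delta,\gamma,\epsilon>0$, $V_*\in\mathcal{A}$, $W_*\in\mathcal{B}$, the pair $(V_*,W_* )$ is $(\delta;\gamma,\epsilon)$-homogeneous if there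 are $V'\subseteq V_*$, $W'\subseteq W_*$ with: (i) $V'\in\mathcal{A}$ and $\mu(V')\geq(1-\gamma)\mu(V_* )$; (ii) $W'\in\mathcal{B}$ and $\nu(W')\geq(1-\gamma)\nu(W_* )$; (iii) there is $r\in[0,1]$ such that for all $b\in W'$, $\mu(\{a\in V_*: f(a,b)\approx_\delta r\})\geq(1-\epsilon)\mu(V_* )$; (iv) there is $s\in[0,1]$ such that for all $a\in V'$, $\nu(\{b\in W_*: f(a,b)\approx_\delta s\})\geq(1-\epsilon)\nu(W_* )$. The pair is $(\delta;\gamma)$-homogeneous if it is $(\delta;\gamma,\gamma)$-homogeneous. *)

(* Defs.v *)
From mathcomp Require Import all_boot all_order all_algebra.
From mathcomp Require Import reals.

Set Implicit Arguments.
Unset Strict Implicit.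
Unset Printing Implicit Defensive.

Import Order.TTheory GRing.Theory Num.Theory.
Local Open Scope ring_scope.

Definition approx (R : realType) (e r s : R) : bool := `|r - s| <= e.

Definition stable (R : realType) (V W : Type) (k : nat) (delta : R)
    (f : V -> W -> R) : Prop :=
  ~ exists (a : 'I_k -> V) (b : 'I_k -> W),
      forall i j : 'I_k, (i < j)%N ->
        `|f (a i) (b j) - f (a j) (b i)| >= delta.

Definition counting_prob (R : realType) (T : finType) (X : {set T}) : R :=
  #|X|%:R / #|T|%:R.

(* (delta; gamma, epsilon)-homogeneity for the normalized counting measures.
   Every subset of a finite type is measurable here, so membership of V' and W'
   in the Boolean algebras holds by typing. *)
Definition homogeneous3 (R : realType) (V W : finType) (f : V -> W -> R)
    (delta gamma epsilon : R) (Vs : {set V}) (Ws : {set W}) : Prop :=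
  let mu := @counting_prob R V in
  let nu := @counting_prob R W in
  exists (V' : {set V}) (W' : {set W}),
    [/\ V' \subset Vs /\ mu V' >= (1 - gamma) * mu Vs,
        W' \subset Ws /\ nu W' >= (1 - gamma) * nu Ws,
        exists2 r : R, 0 <= r <= 1 &
          forall b, b \in W' ->
            mu [set a in Vs | approx delta (f a b) r] >= (1 - epsilon) * mu Vs &
        exists2 s : R, 0 <= s <= 1 &
          forall a, a \in V' ->
            nu [set b in Ws | approx delta (f a b) s] >= (1 - epsilon) * nu Ws].

Definition homogeneous (R : realType) (V W : finType) (f : V -> W -> R)
    (delta gamma : R) (Vs : {set V}) (Ws : {set W}) : Prop :=
  homogeneous3 f delta gamma gamma Vs Ws.

(* P 0, ..., P m partition T, where the exceptional part P 0 may be empty while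
   P 1, ..., P m may not; the values of P beyond m are irrelevant. *)
Definition partition_upto (T : finType) (m : nat) (P : nat -> {set T}) : Prop :=
  [/\ \bigcup_(i < m.+1) P i = [set: T],
      forall i j, (i <= m)%N -> (j <= m)%N -> i != j -> [disjoint P i & P j] &
      forall i, (1 <= i <= m)%N -> P i != set0].

(* Main.v *)
Require Import Defs.
From mathcomp Require Import all_boot all_order all_algebra.
From mathcomp Require Import reals.
From mathcomp Require Import boolp zify ring lra.

Set Implicit Arguments.
Unset Strict Implicit.
Unset Printing Implicit Defensive.

Import Order.TTheory GRing.Theory Num.Theory.
Local Open Scope ring_scope.

(* Fix thresholds p = i * delta and consider binary trees whose nodes b in W
   separate leaves a with f(a, b) <= p from leaves with f(a, b) >= p + 2 delta.
   Stability bounds the height of such trees, so the sum over i of the maximal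
   heights is a bounded rank on subsets of V; if a column splits a set across
   one of these gaps, then one of the two sides has smaller rank. By induction
   on the rank, every set is, up to a small error, a union of boundedly many
   sets that no column splits into two non-negligible sides, where "negligible"
   may depend arbitrarily on the number of sets: pull pieces of smaller rank out
   of a set of rank n until the rest is unsplittable at the present accuracy;
   either little was removed, or the removed mass counts as progress and one
   restarts with a better accuracy. The sharper control |V_0| <= epsilon |V_1|
   comes from choosing V_1 first and then decomposing its complement with an
   error proportional to the guaranteed size of V_1. Finally, if V_i and W_j are
   unsplittable, each column is nearly constant on V_i and each row on W_j, and
   double counting shows that these constants agree. *)

(** * Separation trees and the bound that stability puts on their height *)

Section Trees.
Variables (R : realType) (delta : R) (V W : finType) (f : V -> W -> R).
Implicit Types (X : {set V}) (B : {set W}) (p : R).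

Definition lower p (b : W) : {set V} := [set a | f a b <= p].
Definition upper p (b : W) : {set V} := [set a | p <= f a b].

(** The two subtrees choose their nodes independently, and [X] shrinks along every branch: a leaf
    stands for the points of [X] that obey all decisions above it. *)
Fixpoint tree n p X B : bool :=
  if n is n'.+1 then
    [exists b in B, tree n' p (X :&: lower p b) B &&
                    tree n' p (X :&: upper (p + 2 * delta) b) B]
  else X != set0.

Lemma tree_sub n p X X' B : X \subset X' -> tree n p X B -> tree n p X' B.
Proof.
elim: n X X' => [|n IHn] X X' sXX' /=.
  by rewrite -!subset0; apply: contra; apply: subset_trans.
case/exists_inP=> b Bb /andP[lo hi]; apply/exists_inP; exists b => //.
by rewrite (IHn _ _ (setSI _ sXX') lo) (IHn _ _ (setSI _ sXX') hi).
Qed.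

Lemma treeS n p X B : tree n.+1 p X B -> tree n p X B.
Proof.
elim: n X => [|n IHn] X.
  case/exists_inP=> b _ /andP[lo _].
  by apply: (@tree_sub 0) lo; rewrite subsetIl.
case/exists_inP=> b Bb /andP[lo hi]; apply/exists_inP; exists b => //.
by apply/andP; split; apply: IHn.
Qed.

Lemma tree_leq m n p X B : (m <= n)%N -> tree n p X B -> tree m p X B.
Proof.
elim: n => [|n IHn]; first by rewrite leqn0 => /eqP->.
by rewrite leq_eqVlt => /predU1P[-> //|/IHn{}IHn /treeS].
Qed.

Lemma tree_neq0 n p X B : tree n p X B -> X != set0.
Proof. exact: (@tree_leq 0). Qed.

(** Ramsey argument by induction on [m + n]. If the root lies in [B], either a subtree contains the
    [C]-tree, or both contain [B]-trees of height one less, which the root joins; the case of [C] is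
    symmetric. *)
Lemma tree_pigeonhole m n p X (A B C : {set W}) : A \subset B :|: C ->
  tree (m + n) p X A -> tree m p X B || tree n p X C.
Proof.
move=> sABC; have [N leN] := ubnP (m + n); elim: N m n X leN => // N IHN.
case=> [|m] n X leN; first by move/tree_neq0=> /= ->.
case: n leN => [|n] leN; first by move/tree_neq0=> /= ->; rewrite orbT.
rewrite addSn => /exists_inP[b Ab /andP[lo hi]].
have /setUP[Bb|Cb] := subsetP sABC b Ab.
- have lt_mn : (m + n.+1 < N)%N by lia.
  have [/orP[loB|loC] /orP[hiB|hiC]] :=
    (IHN _ _ _ lt_mn lo, IHN _ _ _ lt_mn hi);
    try by rewrite (tree_sub (subsetIl _ _) loC) ?orbT.
    by apply/orP; left; apply/exists_inP; exists b => //; apply/andP.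
  by rewrite (tree_sub (subsetIl _ _) hiC) ?orbT.
- have lt_mn : (m.+1 + n < N)%N by lia.
  rewrite -addSnnS in lo hi.
  have [/orP[loB|loC] /orP[hiB|hiC]] :=
    (IHN _ _ _ lt_mn lo, IHN _ _ _ lt_mn hi);
    try by rewrite (tree_sub (subsetIl _ _) loB).
    by rewrite (tree_sub (subsetIl _ _) hiB).
  by apply/orP; right; apply/exists_inP; exists b => //; apply/andP.
Qed.

Definition unstable_pair : rel (V * W) :=
  fun u v => delta <= `|f u.1 v.2 - f v.1 u.2|.

(** The pigeonhole step leaves height [(tree_bound k).+1] on one side: its root yields one new pair,
    a subtree below it the other [k]. *)
Fixpoint tree_bound k : nat :=
  if k is k'.+1 then ((tree_bound k').+1 + (tree_bound k').+1)%N else 0%N.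

(* The first pair takes any leaf a1; the nodes of a subtree all lie on one side
   of p + delta in the row of a1, and b1 is the root of that subtree. The other
   side of b1 then contains only pairs in unstable position to (a1, b1). *)
Lemma tree_unstable k p X B : tree (tree_bound k) p X B ->
  exists2 s : seq (V * W), size s = k &
    pairwise unstable_pair s /\ {in s, forall u, u.1 \in X /\ u.2 \in B}.
Proof.
elim: k X B => [|k IHk] X B; first by exists [::].
move=> XB; have /set0Pn[a1 Xa1] := tree_neq0 XB.
(* The midpoint of the gap is at distance [delta] from both ends, the distance that [unstable_pair]
   asks for. *)
pose lowB := [set b in B | f a1 b < p + delta].
pose highB := [set b in B | p + delta <= f a1 b].
have sB : B \subset lowB :|: highB.
  by apply/subsetP=> b Bb; rewrite !inE Bb /=; case: ltP.
have extend (b1 : W) X' B' : b1 \in B -> X' \subset X -> B' \subset B ->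
    (forall a b, a \in X' -> b \in B' -> delta <= `|f a1 b - f a b1|) ->
    tree (tree_bound k) p X' B' ->
  exists2 s : seq (V * W), size s = k.+1 &
    pairwise unstable_pair s /\ {in s, forall u, u.1 \in X /\ u.2 \in B}.
  move=> Bb1 sX' sB' far /IHk[s sz_s [pw_s in_s]].
  exists ((a1, b1) :: s); first by rewrite /= sz_s.
  split=> [|u]; last first.
    rewrite inE => /predU1P[-> //|/in_s[X'u B'u]].
    by rewrite (subsetP sX') ?(subsetP sB').
  rewrite pairwise_cons pw_s andbT; apply/allP=> u /in_s[X'u B'u].
  exact: far.
have /orP[] := tree_pigeonhole sB XB.
- case/exists_inP=> b1; rewrite inE => /andP[Bb1 _] /andP[_ hi].
  apply: extend Bb1 _ _ _ hi; rewrite ?subsetIl ?subsetIr //.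
    by apply/subsetP=> b; rewrite inE => /andP[].
  move=> a b; rewrite !inE => /andP[_ hia] /andP[_ lob].
  by rewrite distrC; apply: le_trans (ler_norm _); lra.
- case/exists_inP=> b1; rewrite inE => /andP[Bb1 _] /andP[lo _].
  apply: extend Bb1 _ _ _ lo; rewrite ?subsetIl ?subsetIr //.
    by apply/subsetP=> b; rewrite inE => /andP[].
  move=> a b; rewrite !inE => /andP[_ loa] /andP[_ hib].
  by apply: le_trans (ler_norm _); lra.
Qed.

Lemma stable_no_tree k p X B : stable k delta f -> ~~ tree (tree_bound k) p X B.
Proof.
move=> st; apply/negP=> XB; have /set0Pn[v0 _] := tree_neq0 XB.
have [s sz_s [pw_s _]] := tree_unstable XB.
apply: st; case: k sz_s {XB} => [|k] sz_s.
  (* For [k = 0] there is no pair to serve as default of [nth]; the empty families already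
     contradict stability. *)
  have no : 'I_0 -> False by case.
  exists (fun i => match no i with end), (fun i => match no i with end).
  by case.
case: s sz_s pw_s => // u s sz_s /(pairwiseP u) pw_s.
exists (fun i : 'I_k.+1 => (nth u (u :: s) i).1),
       (fun i : 'I_k.+1 => (nth u (u :: s) i).2) => i j ltij.
by apply: pw_s; rewrite ?inE ?sz_s.
Qed.

End Trees.

(** * Disjoint unions as lists of sets *)

Section Splits.
Variable V : finType.
Implicit Types (A B P X Y : {set V}) (s : seq {set V}).

(* The boolean x \in X is read as 0 or 1: X is the disjoint union of s. *)
Definition splits X s :=
  forall x, count (fun P : {set V} => x \in P) s = (x \in X) :> nat.

Lemma splits_card X s : splits X s -> #|X| = (\sum_(P <- s) #|P|)%N.
Proof.
move=> sX; rewrite -sum1_card big_mkcond.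
transitivity (\sum_x \sum_(P <- s) (x \in P : nat))%N.
  apply: eq_bigr => x _; rewrite -mulnbl muln1 -sX -sum1_count big_mkcond.
  by apply: eq_bigr.
rewrite exchange_big; apply: eq_bigr => P _.
by rewrite -sum1_card [RHS]big_mkcond.
Qed.

Lemma splitsD X Y : Y \subset X -> splits X [:: Y; X :\: Y].
Proof.
move=> sYX x; rewrite /= inE.
by have := subsetP sYX x; case: (x \in Y) => [->|_] //; case: (x \in X).
Qed.

(** The heads are exceptional sets and get merged, while the lists of genuine parts are
    concatenated. *)
Lemma splits_cat X A B A0 B0 s1 s2 : splits X [:: A; B] ->
  splits A (A0 :: s1) -> splits B (B0 :: s2) ->
  splits X ((A0 :|: B0) :: s1 ++ s2).
Proof.
move=> sX sA sB x; have := (sX x, sA x, sB x); rewrite /= count_cat inE.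
move: (count _ s1) (count _ s2) => c1 c2.
by case: (x \in A0) (x \in B0) (x \in A) (x \in B) (x \in X)
  => -[] [] [] [] [[/= ? ?] ?]; lia.
Qed.

Lemma card_splits2 (F : numDomainType) X A B : splits X [:: A; B] ->
  #|X|%:R = #|A|%:R + #|B|%:R :> F.
Proof. by move/splits_card->; rewrite !big_cons big_nil addn0 natrD. Qed.

Lemma splits_subset X s P : splits X s -> P \in s -> P \subset X.
Proof.
move=> sX sP; apply/subsetP=> x Px; rewrite -[x \in X]lt0b -sX -has_count.
by apply/hasP; exists P.
Qed.

End Splits.

Lemma leq_bigmax_ord (F : nat -> nat) m n :
  (m <= n)%N -> (F m <= \max_(i < n.+1) F i)%N.
Proof.
move=> lemn.
exact: (@leq_bigmax _ (fun i : 'I_n.+1 => F i) (Ordinal (lemn : m < n.+1)%N)).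
Qed.

(** * Running minima *)

Section LowerEnvelope.
Variable R : realDomainType.

(** A single accuracy that serves all indices up to [n], for [g] not necessarily monotone. *)
Fixpoint low (g : nat -> R) n : R :=
  if n is n'.+1 then Num.min (low g n') (g n) else g 0%N.

Lemma low_gt0 g n : (forall m, 0 < g m) -> 0 < low g n.
Proof. by move=> g0; elim: n => //= n IHn; rewrite lt_min IHn g0. Qed.

Lemma low_le g m n : (m <= n)%N -> low g n <= g m.
Proof.
elim: n => [|n IHn] /=; first by rewrite leqn0 => /eqP->.
rewrite leq_eqVlt => /predU1P[->|/IHn]; rewrite ge_min ?lexx ?orbT //.
by move->.
Qed.

End LowerEnvelope.

(** * Decomposition into unsplittable sets *)

Section Decomposition.
Variables (R : realType) (delta : R) (L : nat).

(** Thresholds advance by [delta] while the gaps have width [2 * delta], so consecutive gaps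
    overlap. *)
Definition unsplittable (V W : finType) (f : V -> W -> R) (g : R)
    (X : {set V}) :=
  forall (b : W) (i : 'I_L),
    #|X :&: lower f (i%:R * delta) b|%:R <= g * #|X|%:R \/
    #|X :&: upper f (i%:R * delta + 2 * delta) b|%:R <= g * #|X|%:R.

Lemma unsplittable_le (V W : finType) (f : V -> W -> R) g g' X :
  g <= g' -> unsplittable f g X -> unsplittable f g' X.
Proof.
move=> legg' uX b i.
have leX : g * #|X|%:R <= g' * #|X|%:R by rewrite ler_wpM2r ?ler0n.
by have [leb|leb] := uX b i; [left|right]; apply: le_trans leb leX.
Qed.

(** A class ranges over all [V], [W] and [f] at once, so that the bound [M] below can be uniform in
    them. *)
Definition set_class := forall V W : finType, (V -> W -> R) -> {set V} -> Prop.

(** The error is measured against all of [V], so errors of different pieces simply add up. *)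
Definition decomposition (V W : finType) (f : V -> W -> R) (X : {set V})
    (e : R) (g : nat -> R) (M : nat) (X0 : {set V}) (s : seq {set V}) :=
  [/\ splits X (X0 :: s), (size s <= M)%N, #|X0|%:R <= e * #|V|%:R &
      forall P, P \in s -> P != set0 /\ unsplittable f (g (size s)) P].

Definition decomposable (C : set_class) :=
  forall (e : R) (g : nat -> R), 0 < e -> (forall n, 0 < g n) ->
  exists M, forall (V W : finType) (f : V -> W -> R) (X : {set V}),
    C V W f X -> exists X0 s, decomposition f X e g M X0 s.

Definition class_union (C1 C2 : set_class) : set_class := fun V W f X =>
  exists A B, [/\ splits X [:: A; B], C1 V W f A & C2 V W f B].

(* The first set is decomposed with a homogeneity that already anticipates
   every possible number of parts of the second one. *)
Lemma decomposable_union C1 C2 :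
  decomposable C1 -> decomposable C2 -> decomposable (class_union C1 C2).
Proof.
move=> dC1 dC2 e g e0 g0; have e20 : 0 < e / 2 by rewrite divr_gt0.
have [M2 decC2] :=
  choice (fun m => dC2 _ (fun n => g (m + n)%N) e20 (fun=> g0 _)).
pose g1 m := low (fun n => g (m + n)%N) (M2 m).
have [M1 decC1] := dC1 _ g1 e20 (fun=> low_gt0 _ (fun=> g0 _)).
exists (M1 + \max_(m < M1.+1) M2 m)%N => V W f X [A [B [sX C1A C2B]]].
have [A0 [s1 [sA le_s1 leA0 us1]]] := decC1 _ _ _ _ C1A.
have [B0 [s2 [sB le_s2 leB0 us2]]] := decC2 (size s1) _ _ _ _ C2B.
exists (A0 :|: B0), (s1 ++ s2); split.
- exact: splits_cat sX sA sB.
- rewrite size_cat leq_add // (leq_trans le_s2) //.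
  exact: leq_bigmax_ord.
- apply: le_trans (_ : #|A0|%:R + #|B0|%:R <= _).
    by rewrite -natrD ler_nat cardsU leq_subr.
  by rewrite [e]splitr mulrDl lerD.
- move=> P; rewrite size_cat mem_cat => /orP[/us1|/us2] [P0 uP]; split=> //.
  by apply: unsplittable_le uP; apply: low_le.
Qed.

Section Ranked.
(** [D n] abstracts the sets of rank at most [n]. *)
Variable D : nat -> set_class.
Hypothesis D0 : forall (V W : finType) (f : V -> W -> R) X, D 0 f X -> X = set0.
Hypothesis D_set0 : forall n (V W : finType) (f : V -> W -> R), D n f set0.
Hypothesis D_sub : forall n (V W : finType) (f : V -> W -> R) (X Y : {set V}),
  X \subset Y -> D n f Y -> D n f X.
Hypothesis D_split : forall n (V W : finType) (f : V -> W -> R) X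
    (b : W) (i : 'I_L),
  D n.+1 f X -> D n f (X :&: lower f (i%:R * delta) b) \/
                D n f (X :&: upper f (i%:R * delta + 2 * delta) b).

Lemma decomposable0 : decomposable (D 0).
Proof.
move=> e g e0 g0; exists 0%N => V W f X DX; rewrite (D0 DX).
exists set0, [::]; split=> //; first by move=> x; rewrite /= inE.
by rewrite cards0 mulr_ge0 ?ler0n ?ltW.
Qed.

Fixpoint unions n t : set_class :=
  if t is t'.+1 then class_union (unions n t') (@D n)
  else fun V W f X => X = set0.

Lemma unions_decomposable n t : decomposable (D n) -> decomposable (unions n t).
Proof.
move=> dD; elim: t => [|t IHt]; last exact: decomposable_union.
move=> e g e0 g0; exists 0%N => V W f X ->.
exists set0, [::]; split=> //; first by move=> x; rewrite /= inE.
by rewrite cards0 mulr_ge0 ?ler0n ?ltW.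
Qed.

Lemma unionsS n t (V W : finType) (f : V -> W -> R) X :
  unions n t f X -> unions n t.+1 f X.
Proof.
move=> uX; exists X, set0; split=> // x.
by rewrite /= inE; case: (x \in X).
Qed.

(** State after [q] rounds: [Q] has moved from [Y] to [Z], and [Y'] is the rest. The first
    alternative says that the rounds so far all removed much; the others are reasons to stop. *)
Definition pulled n t q (g e : R) (V W : finType) (f : V -> W -> R)
    (X Z Y : {set V}) :=
  exists Q Z' Y', [/\ splits Y [:: Q; Y'], splits X [:: Z'; Y'],
    splits Z' [:: Z; Q], unions n (t + q) f Z' &
    [\/ q%:R * (g * e) * #|V|%:R <= #|Q|%:R, unsplittable f g Y'
      | #|Y'|%:R <= e * #|V|%:R]].

(** While the rest is neither small nor unsplittable, some column leaves both sides of a gap large;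
    by [D_split] one of them has smaller rank and is pulled. *)
Lemma pull_out n t q (g e : R) (V W : finType) (f : V -> W -> R) X Z Y :
    0 < g -> 0 < e -> splits X [:: Z; Y] -> unions n t f Z -> D n.+1 f Y ->
  pulled n t q g e f X Z Y.
Proof.
move=> g0 e0 sX uZ DY; elim: q => [|q [Q [Z' [Y' [sY sXZ' sZ' uZ' alt]]]]].
  exists set0, Z, Y; rewrite addn0; split=> //.
  - by move=> x; rewrite /= inE; case: (x \in Y).
  - by move=> x; rewrite /= inE; case: (x \in Z).
  - by constructor 1; rewrite cards0 !mul0r.
(* After stopping, further rounds pull the empty set. *)
have stop : unsplittable f g Y' \/ #|Y'|%:R <= e * #|V|%:R ->
    pulled n t q.+1 g e f X Z Y.
  move=> altY; exists Q, Z', Y'; split=> //.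
    by rewrite addnS; apply: unionsS.
  by case: altY; [constructor 2 | constructor 3].
case: alt => [leQ|uY'|leY'];
  [|by apply: stop; left|by apply: stop; right].
have [leY'|ltY'] := leP #|Y'|%:R (e * #|V|%:R); first by apply: stop; right.
have [uY'|nuY'] := pselect (unsplittable f g Y'); first by apply: stop; left.
have pull (P : {set V}) : P \subset Y' -> g * #|Y'|%:R < #|P|%:R -> D n f P ->
    pulled n t q.+1 g e f X Z Y.
  move=> /splitsD sY' ltP DP.
  have sQP : splits (Q :|: P) [:: Q; P].
    move=> x; have := (sY x, sY' x); rewrite /= !inE.
    by case: (x \in Q) (x \in P) (x \in Y') (x \in Y) => -[] [] [] [].
  exists (Q :|: P), (Z' :|: P), (Y' :\: P); split.
  - move=> x; have := (sY x, sY' x); rewrite /= !inE.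
    by case: (x \in Q) (x \in P) (x \in Y') (x \in Y) => -[] [] [] [].
  - move=> x; have := (sXZ' x, sY' x); rewrite /= !inE.
    by case: (x \in Z') (x \in P) (x \in Y') (x \in X) => -[] [] [] [].
  - move=> x; move: (sXZ' x) (sZ' x) (sY x) (sY' x); rewrite /= !inE.
    by case: (x \in Z) (x \in Z') (x \in P) (x \in Q) (x \in Y') (x \in Y)
             (x \in X) => -[] [] [] [] [] [].
  - rewrite addnS; exists Z', P; split=> // x.
    have := (sXZ' x, sY' x); rewrite /= !inE.
    by case: (x \in Z') (x \in P) (x \in Y') (x \in X) => -[] [] [] [].
  - constructor 1; rewrite (card_splits2 _ sQP) -natr1 -mulrA mulrDl mul1r.
    rewrite mulrA lerD //.
    by apply/ltW/(lt_trans _ ltP); rewrite -mulrA ltr_pM2l.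
have DY' : D n.+1 f Y'.
  by apply: D_sub DY; apply: (splits_subset sY); rewrite !inE eqxx orbT.
have [b [i [lo hi]]] : exists b (i : 'I_L),
    g * #|Y'|%:R < #|Y' :&: lower f (i%:R * delta) b|%:R /\
    g * #|Y'|%:R < #|Y' :&: upper f (i%:R * delta + 2 * delta) b|%:R.
  apply: contrapT => no; apply: nuY' => b i.
  have [|lo] := leP #|Y' :&: lower f (i%:R * delta) b|%:R (g * #|Y'|%:R).
    by left.
  right; rewrite leNgt; apply/negP=> hi; apply: no.
  by exists b, i.
by have [|] := D_split b i DY'; apply: pull; rewrite ?subsetIl.
Qed.

(* Y has rank n.+1 and mass at most j * e / 3. Pulling sets of rank n out of Y
   until the rest is homogeneous either removes little, and what was removed
   goes to the exceptional set, or decreases j. *)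
Lemma decompose_rest n (e : R) (g : nat -> R) j t : decomposable (D n) ->
    0 < e -> (forall n, 0 < g n) ->
  exists M, forall (V W : finType) (f : V -> W -> R) X Z Y,
    splits X [:: Z; Y] -> unions n t f Z -> D n.+1 f Y ->
    #|Y|%:R <= j%:R * (e / 3) * #|V|%:R ->
    exists X0 s, decomposition f X e g M X0 s.
Proof.
move=> dD e0 g0; have e30 : 0 < e / 3 by rewrite divr_gt0.
elim: j t => [|j IHj] t.
  have [M decM] := unions_decomposable t dD e0 g0.
  exists M => V W f X Z Y sX uZ DY.
  rewrite !mul0r lern0 cards_eq0 => /eqP Y0.
  apply: decM; suff -> : X = Z by [].
  apply/setP=> x; have := sX x; rewrite Y0 /= inE.
  by case: (x \in X) (x \in Z) => -[].
(* The [m] parts of [Z] end up alone or together with [Y']. *)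
pose g' m := Num.min (g m) (g m.+1).
have g'0 m : 0 < g' m by rewrite lt_min !g0.
have [M decM] := unions_decomposable t dD e30 g'0.
(* [Y'] joins at most [M] parts, whose number is not yet known. *)
pose gam := low g M.+1; have gam0 : 0 < gam by apply: low_gt0.
(* So many full rounds would remove more than all of a nonempty [V]. *)
pose q := (Num.truncn ((gam * (e / 3))^-1)).+1.
have q_gt : 1 < q%:R * (gam * (e / 3)).
  by rewrite -ltr_pdivrMr ?div1r ?truncnS_gt // mulr_gt0.
have [M' decM'] := IHj (t + q)%N.
exists (maxn M.+1 M') => V W f X Z Y sX uZ DY leY.
have [Q [Z' [Y' [sY sXZ' sZ' uZ' alt]]]] := pull_out q gam0 e30 sX uZ DY.
have DY' : D n.+1 f Y'.
  by apply: D_sub DY; apply: (splits_subset sY); rewrite !inE eqxx orbT.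
have [leQ|gtQ] := leP #|Q|%:R (e / 3 * #|V|%:R); last first.
  have [|X0 [s [sX0 le_s leX0 us]]] := decM' _ _ _ _ _ _ sXZ' uZ' DY'.
    move: leY; rewrite (card_splits2 _ sY) -natr1 -!mulrA mulrDl mul1r.
    by move: gtQ; lra.
  by exists X0, s; split=> //; rewrite (leq_trans le_s) ?leq_maxr.
have [Z0 [s [sZ le_s leZ0 us]]] := decM _ _ _ _ uZ.
have disc : #|Y'|%:R <= e / 3 * #|V|%:R ->
    exists X0 s, decomposition f X e g (maxn M.+1 M') X0 s.
  move=> leY'; exists (Z0 :|: Y), s; split.
  - have sYY : splits Y [:: Y] by move=> x; rewrite /= addn0.
    by have := splits_cat sX sZ sYY; rewrite cats0.
  - by rewrite leq_max (leqW le_s).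
  - apply: le_trans (_ : #|Z0|%:R + #|Y|%:R <= _).
      by rewrite -natrD ler_nat cardsU leq_subr.
    rewrite (card_splits2 _ sY); move: leZ0 leQ leY'.
    by rewrite [e / 3 * _]mulrAC; lra.
  - move=> P /us[P0 uP]; split=> //; apply: unsplittable_le uP.
    by rewrite ge_min lexx.
have [Y'0|Y'0] := eqVneq Y' set0.
  by apply: disc; rewrite Y'0 cards0 mulr_ge0 ?ler0n ?ltW.
have V0 : 0 < #|V|%:R :> R.
  by rewrite ltr0n; case/set0Pn: Y'0 => x _; apply/card_gt0P; exists x.
case: alt => [big|uY'|]; last exact: disc.
  have : #|Q|%:R <= #|V|%:R :> R by rewrite ler_nat max_card.
  by rewrite leNgt (lt_le_trans _ big) // -[ltLHS]mul1r ltr_pM2r.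
exists (Z0 :|: Q), (s ++ [:: Y']); split.
- by apply: splits_cat sX sZ _ => x; have := sY x.
- by rewrite size_cat addn1 leq_max ltnS le_s.
- apply: le_trans (_ : #|Z0|%:R + #|Q|%:R <= _).
    by rewrite -natrD ler_nat cardsU leq_subr.
  apply: le_trans (lerD leZ0 leQ) _; rewrite -mulrDl ler_pM2r //.
  by lra.
- move=> P; rewrite size_cat addn1 mem_cat inE.
  case/orP=> [/us[P0 uP]|/eqP->]; split=> //.
    by apply: unsplittable_le uP; rewrite ge_min lexx orbT.
  by apply: unsplittable_le uY'; apply: low_le.
Qed.

Lemma decomposable_ranked n : decomposable (D n).
Proof.
elim: n => [|n IHn]; first exact: decomposable0.
move=> e g e0 g0.
(* Now [j * (e / 3)] exceeds 1, so any [X] meets the initial mass bound with nothing pulled yet. *)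
pose j := (Num.truncn (e / 3)^-1).+1.
have [M decM] := decompose_rest j 0 IHn e0 g0.
exists M => V W f X DX; apply: (decM _ _ _ _ set0 X) => //.
  by move=> x; rewrite /= inE addn0.
apply: le_trans (_ : #|V|%:R <= _); first by rewrite ler_nat max_card.
rewrite -[leLHS]mul1r ler_wpM2r ?ler0n //.
by rewrite -ler_pdivrMr ?div1r ?(ltW (truncnS_gt _)) // divr_gt0.
Qed.

End Ranked.
End Decomposition.

(** Each point has exactly one membership among the listed sets, which gives both covering and
    disjointness; the exceptional set gets index 0. *)
Lemma splits_partition (V : finType) (X0 : {set V}) (s : seq {set V}) :
  splits [set: V] (X0 :: s) -> {in s, forall P, P != set0} ->
  partition_upto (size s) (nth set0 (X0 :: s)).
Proof.
move=> sV s0; set t := X0 :: s.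
have cover x : (\sum_(i < (size s).+1) (x \in nth set0 t i) = 1)%N.
  transitivity (count (fun P : {set V} => x \in P) t);
    last by rewrite sV in_setT.
  by rewrite -sum1_count (big_nth set0) big_mkord [RHS]big_mkcond.
split.
- apply/setP=> x; rewrite in_setT; apply/bigcupP.
  have [i xi] : exists i : 'I_(size s).+1, x \in nth set0 t i.
    apply/existsP; apply: contraPT (cover x).
    rewrite negb_exists => /forallP no.
    by rewrite big1 // => i _; rewrite (negPf (no i)).
  by exists i.
- move=> i j lei lej neqij; rewrite -setI_eq0; apply/eqP/setP=> x.
  rewrite in_setI in_set0; apply/negbTE/negP=> /andP[xi xj].
  move: (cover x) {sV}; clearbody t.
  rewrite -ltnS in lei; rewrite -ltnS in lej.
  pose i' := Ordinal lei; pose j' := Ordinal lej.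
  have neqji : j' != i' by rewrite -val_eqE /= eq_sym.
  by rewrite (bigD1 i') //= xi (bigD1 j') //= xj.
- by move=> [//|i] lei; apply/s0/mem_nth.
Qed.

(** * The rank by tree heights, and partitions with a small exceptional set *)

Section Rank.
Variables (R : realType) (delta : R) (L : nat).
Hypothesis L_gt0 : (0 < L)%N.

(** Each [c i] is a strict bound on the height at one threshold; by summation, a drop at any single
    threshold lowers the rank. *)
Definition rank_le n : set_class R := fun V W f X =>
  exists c : 'I_L -> nat, (\sum_i c i <= n)%N /\
    forall i, ~~ tree delta f (c i) (i%:R * delta) X [set: W].

Lemma rank_le0 (V W : finType) (f : V -> W -> R) X : rank_le 0 f X -> X = set0.
Proof.
case=> c [c0 noX]; have /= := noX (Ordinal L_gt0).
have -> : c (Ordinal L_gt0) = 0%N.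
  apply/eqP; rewrite -leqn0 (leq_trans _ c0) //.
  by rewrite (bigD1 (Ordinal L_gt0)) //= leq_addr.
by rewrite negbK => /eqP.
Qed.

Lemma rank_le_set0 n (V W : finType) (f : V -> W -> R) : rank_le n f set0.
Proof.
exists (fun=> 0%N); rewrite sum_nat_const muln0; split=> // i /=.
by rewrite eqxx.
Qed.

Lemma rank_le_sub n (V W : finType) (f : V -> W -> R) (X Y : {set V}) :
  X \subset Y -> rank_le n f Y -> rank_le n f X.
Proof.
move=> sXY [c [cn noY]]; exists c; split=> // i.
by apply: contra (noY i); apply: tree_sub.
Qed.

(** Trees of height [m] on both sides would be joined by the root [b] into one of height
    [m.+1 = c i]. *)
Lemma rank_le_split n (V W : finType) (f : V -> W -> R) (X : {set V}) (b : W)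
    (i : 'I_L) : rank_le n.+1 f X ->
  rank_le n f (X :&: lower f (i%:R * delta) b) \/
  rank_le n f (X :&: upper f (i%:R * delta + 2 * delta) b).
Proof.
case=> c [cn noX]; case Dci: (c i) => [|m].
  have := noX i; rewrite Dci /= negbK => /eqP->.
  by left; rewrite set0I; apply: rank_le_set0.
pose c' j := if j == i then m else c j.
have c'n : (\sum_j c' j <= n)%N.
  move: cn; rewrite (bigD1 i) // [in X in _ -> X](bigD1 i) //= /c' eqxx Dci.
  rewrite addSn ltnS.
  by congr (_ + _ <= _)%N; apply: eq_bigr => j /negPf->.
have lowered (X' : {set V}) : X' \subset X ->
    ~~ tree delta f m (i%:R * delta) X' [set: W] -> rank_le n f X'.
  move=> sX' noX'; exists c'; split=> // j; rewrite /c'.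
  by case: eqP => [->|_] //; apply: contra (noX j); apply: tree_sub.
have := noX i; rewrite Dci /= negb_exists => /forallP/(_ b).
by rewrite in_setT /= negb_and => /orP[no|no]; [left|right];
  apply: lowered (subsetIl _ _) no.
Qed.

Lemma stable_rank_le k (V W : finType) (f : V -> W -> R) X :
  0 < delta -> stable k delta f -> rank_le (L * tree_bound k)%N f X.
Proof.
move=> d0 st; exists (fun=> tree_bound k); rewrite sum_nat_const card_ord.
by split=> // i; apply: stable_no_tree.
Qed.

Lemma rank_le_decomposable n : decomposable delta L (rank_le n).
Proof.
apply: (decomposable_ranked (D := rank_le)).
- exact: rank_le0.
- exact: rank_le_set0.
- exact: rank_le_sub.
- exact: rank_le_split.
Qed.

Lemma stable_partition k (e : R) (g : nat -> R) : 0 < delta -> 0 < e ->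
    (forall n, 0 < g n) ->
  exists M, forall (V W : finType) (f : V -> W -> R),
    (0 < #|V|)%N -> stable k delta f ->
    exists X0 X1 s, [/\ splits [set: V] [:: X0, X1 & s], (size s < M)%N,
      #|X0|%:R <= e * #|X1|%:R &
      {in X1 :: s, forall P,
        P != set0 /\ unsplittable delta L f (g (size s).+1) P}].
Proof.
move=> d0 e0 g0; have dec := rank_le_decomposable (L * tree_bound k)%N.
(* If the first decomposition has [m] parts, then [X1] will have at least [#|V| / (2 * m.+1)]
   points. *)
have e'0 m : 0 < e / (2 * m.+1%:R) by rewrite divr_gt0 ?mulr_gt0 ?ltr0n.
have [M' decM'] :=
  choice (fun m => dec _ (fun n => g n.+1) (e'0 m) (fun=> g0 _)).
have half0 : 0 < 2^-1 :> R by rewrite invr_gt0.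
(* The accuracy of [X1] anticipates every possible number [n] of parts of its complement; [n.+1]
   counts [X1] too. *)
have [M decM] := dec _ (fun m => low (fun n => g n.+1) (M' m)) half0
  (fun=> low_gt0 _ (fun=> g0 _)).
exists (\max_(m < M.+1) M' m).+1 => V W f V0 st.
have V0R : 0 < #|V|%:R :> R by rewrite ltr0n.
have [Y0 [t [st_t le_t leY0 ut]]] :=
  decM V W f _ (stable_rank_le [set: V] d0 st).
(* Otherwise [t] would cover less than half of [V]; the successor keeps this strict, also for empty
   [t]. *)
have [X1 tX1 bigX1] : exists2 X1, X1 \in t &
    #|V|%:R <= 2 * (size t).+1%:R * #|X1|%:R :> R.
  apply: contrapT => no.
  have small P : P \in t -> 2 * (size t).+1%:R * #|P|%:R < #|V|%:R :> R.
    by move=> tP; rewrite ltNge; apply/negP=> big; apply: no; exists P.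
  pose K := #|V|%:R / (2 * (size t).+1%:R) : R.
  have n0 : 0 < 2 * (size t).+1%:R :> R by rewrite mulr_gt0 ?ltr0n.
  have leK : (\sum_(P <- t) #|P|)%:R <= (size t)%:R * K.
    rewrite -sum1_size natr_sum natr_sum mulr_suml !big_seq ler_sum // => P tP.
    by rewrite mul1r ler_pdivlMr // mulrC ltW ?small.
  have V0K : #|V|%:R = 2 * (size t)%:R * K + 2 * K.
    rewrite -[LHS](divfK (lt0r_neq0 n0)) -/K -natr1; ring.
  have K0 : 0 < K by rewrite divr_gt0.
  have := splits_card st_t; rewrite cardsT big_cons.
  move/(congr1 (fun n => n%:R : R)); rewrite natrD.
  move: leY0 leK; rewrite V0K; lra.
have V1 : #|V|%:R / (2 * (size t).+1%:R) <= #|X1|%:R :> R.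
  by rewrite ler_pdivrMr ?mulr_gt0 ?ltr0n // mulrC.
have [X10 uX1] := ut _ tX1.
have [Z0 [s [sZ le_s leZ0 us]]] :=
  decM' (size t) V W f _ (stable_rank_le (~: X1) d0 st).
exists Z0, X1, s; split.
- move=> x; have := sZ x; rewrite /= !inE.
  by move=> sx; rewrite addnCA sx; case: (x \in X1).
- rewrite ltnS (leq_trans le_s) //.
  exact: leq_bigmax_ord.
- by apply: le_trans leZ0 _; rewrite -mulrA [_^-1 * _]mulrC ler_pM2l.
- move=> P; rewrite inE => /predU1P[->|/us//]; split=> //.
  exact: unsplittable_le (low_le _ le_s) uX1.
Qed.
End Rank.

(** * From unsplittable sets to homogeneous pairs *)

Section Homogeneity.
Variables (R : realType) (V W : finType) (f : V -> W -> R).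
Implicit Types (X : {set V}) (Y : {set W}).

Definition concentrated (eta gam : R) X := forall b,
  exists2 r : R, 0 <= r <= 1 &
    (1 - gam) * #|X|%:R <= #|[set a in X | approx eta (f a b) r]|%:R.

(** Take the least [j] with a non-negligible part of [X] at or below [j * delta]. Values from
    [(j + 2) * delta] on are rare as [X] is unsplittable, values up to [(j - 1) * delta] by
    minimality; a window of width [3 * delta] remains. *)
Lemma unsplittable_concentrated delta L g X :
  0 < delta -> 1 <= L.-1%:R * delta -> 0 < g < 1 ->
  (forall a b, 0 <= f a b <= 1) ->
  unsplittable delta L f g X -> concentrated (3 / 2 * delta) (2 * g) X.
Proof.
move=> d0 L1 /andP[g0 g1] f01 uX b.
have [->|X0] := eqVneq X set0.
  by exists 0; rewrite ?lexx ?ler01 // !cards0 mulr0.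
have X0R : 0 < #|X|%:R :> R by rewrite ltr0n card_gt0.
pose big j := g * #|X|%:R < #|X :&: lower f (j%:R * delta) b|%:R.
have bigL : big L.-1.
  rewrite /big (_ : X :&: _ = X) ?gtr_pMl //.
  apply/setIidPl/subsetP=> a _; rewrite inE (le_trans _ L1) //.
  by case/andP: (f01 a b).
have [j bigj minj] := ex_minnP (ex_intro big _ bigL).
have ltjL : (j < L)%N.
  have := minj _ bigL; case: (L) L1 => //.
  by rewrite mul0r ler10.
have highj : #|X :&: upper f (j%:R * delta + 2 * delta) b|%:R <= g * #|X|%:R.
  by have [|//] := uX b (Ordinal ltjL); rewrite leNgt => /negP[].
pose below := [set a in X | f a b <= (j%:R - 1) * delta].
have lowj : #|below|%:R <= g * #|X|%:R.
  (* For [j = 0] the threshold is negative and nothing lies below it. *)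
  case: j minj {bigj highj ltjL} @below => [|j] minj; rewrite /=.
    rewrite (_ : [set a in X | _] = set0) ?cards0 ?mulr_ge0 ?ler0n ?(ltW g0) //.
    apply/setP=> a; rewrite !inE sub0r mulN1r; apply/negbTE.
    rewrite negb_and -ltNge; case/andP: (f01 a b) => fa0 _.
    by rewrite (lt_le_trans _ fa0) ?orbT // oppr_lt0.
  have := contraNN (minj j); rewrite ltnn => /(_ isT); rewrite /big -leNgt.
  congr (_ <= _); congr (#|pred_of_set _|%:R); apply/setP=> a.
  by rewrite !inE -natr1 addrK.
pose above := X :&: upper f (j%:R * delta + 2 * delta) b.
(* The centre of the window, capped to stay in the unit interval; as [f] is at most 1, the cap does
   not spoil the distance bound. *)
pose r := Num.min ((j%:R + 1 / 2) * delta) 1.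
have r01 : 0 <= r <= 1.
  rewrite le_min ler01 ge_min lexx orbT !andbT.
  by rewrite mulr_ge0 ?(ltW d0) ?addr_ge0 ?ler0n ?divr_ge0.
exists r => //; set G := [set a in X | _].
have sX : X \subset G :|: (below :|: above).
  apply/subsetP=> a Xa; rewrite !inE Xa /=.
  have [//|lo] := leP (f a b) ((j%:R - 1) * delta); rewrite ?orbT //=.
  have [//|hi] := leP (j%:R * delta + 2 * delta) (f a b); rewrite ?orbT //=.
  rewrite !orbF /approx; have /andP[_ fa1] := f01 a b.
  rewrite ler_norml /r; move: lo hi fa1.
  case: (leP ((j%:R + 1 / 2) * delta) 1) => le1 lo hi fa1;
    by apply/andP; split; lra.
have : #|X|%:R <= #|G|%:R + (#|below|%:R + #|above|%:R) :> R.
  rewrite -!natrD ler_nat (leq_trans (subset_leq_card sX)) //.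
  by rewrite (leq_trans (leq_card_setU _ _)) // leq_add2l leq_card_setU.
by move: lowj highj; rewrite -/above; lra.
Qed.

End Homogeneity.

Lemma card_sep_sum (T : finType) (A : {set T}) (P : pred T) :
  #|[set x in A | P x]| = (\sum_(x in A) P x)%N.
Proof.
rewrite -sum1_card big_mkcond [RHS]big_mkcond; apply: eq_bigr => x _.
by rewrite inE; case: (x \in A).
Qed.

Lemma card_sepC (F : numDomainType) (T : finType) (A : {set T}) (P : pred T) :
  #|A|%:R = #|[set x in A | P x]|%:R + #|[set x in A | ~~ P x]|%:R :> F.
Proof.
rewrite -natrD !card_sep_sum -big_split -sum1_card; congr _%:R.
by apply: eq_bigr => x _; case: (P x).
Qed.

(* By double counting some row a0 in X agrees with the typical column values on
   most of Y; its typical value is then within 2 eta of those column values. *)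
Lemma concentrated_pair (R : realType) (V W : finType) (f : V -> W -> R)
    (eta gam : R) (X : {set V}) (Y : {set W}) : X != set0 ->
    concentrated f eta gam X -> concentrated (fun b a => f a b) eta gam Y ->
  exists2 Y' : {set W}, Y' \subset Y /\ (1 - 2 * gam) * #|Y|%:R <= #|Y'|%:R &
    exists2 r : R, 0 <= r <= 1 & forall b, b \in Y' ->
      (1 - gam) * #|X|%:R <= #|[set a in X | approx (3 * eta) (f a b) r]|%:R.
Proof.
move=> X0 cX cY.
have /choice[r rP] : forall b, exists r : R, 0 <= r <= 1 /\
    (1 - gam) * #|X|%:R <= #|[set a in X | approx eta (f a b) r]|%:R.
  by move=> b; have [r] := cX b; exists r.
have X0R : 0 < #|X|%:R :> R by rewrite ltr0n card_gt0.
have [a0 Xa0 few] : exists2 a, a \in X &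
    #|[set b in Y | ~~ approx eta (f a b) (r b)]|%:R <= gam * #|Y|%:R.
  apply: contrapT => no.
  have : \sum_(a in X) gam * #|Y|%:R <
      \sum_(a in X) #|[set b in Y | ~~ approx eta (f a b) (r b)]|%:R.
    apply: ltr_sum => [|a Xa].
      by case/set0Pn: X0 => a Xa; apply/hasP; exists a; rewrite ?mem_index_enum.
    by rewrite ltNge; apply/negP=> le_a; apply: no; exists a.
  rewrite ltNge -natr_sum; under eq_bigr do rewrite card_sep_sum.
  rewrite exchange_big natr_sum /= sumr_const -[_ *+ _]mulr_natr.
  under eq_bigr do rewrite -card_sep_sum.
  suff leb b :
      #|[set a in X | ~~ approx eta (f a b) (r b)]|%:R <= gam * #|X|%:R.
    rewrite (le_trans (ler_sum _ (fun b _ => leb b))) //.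
    by rewrite sumr_const -[_ *+ _]mulr_natr mulrAC.
  have [_] := rP b; have := card_sepC R X (fun a => approx eta (f a b) (r b)).
  by lra.
have [s s01 leYs] := cY a0.
pose Y' := [set b in Y | approx eta (f a0 b) s && approx eta (f a0 b) (r b)].
exists Y'; first split.
- by apply/subsetP=> b; rewrite inE => /andP[].
- have sY : Y \subset Y' :|: ([set b in Y | ~~ approx eta (f a0 b) s] :|:
      [set b in Y | ~~ approx eta (f a0 b) (r b)]).
    apply/subsetP=> b Yb; rewrite !inE Yb /=.
    by case: (approx _ _ s); case: (approx _ _ (r b)).
  have := leq_trans (subset_leq_card sY) (leq_card_setU _ _).
  move/leq_trans/(_ (leq_add (leqnn _) (leq_card_setU _ _))).
  rewrite -(ler_nat R) !natrD.
  by have := card_sepC R Y (fun b => approx eta (f a0 b) s); lra.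
- exists s => // b; rewrite inE => /and3P[Yb near_s near_r].
  have [_ /le_trans->] := rP b => //; rewrite ler_nat subset_leq_card //.
  apply/subsetP=> a; rewrite !inE => /andP[-> /=].
  move: near_s near_r; rewrite /approx !ler_norml.
  by move=> /andP[? ?] /andP[? ?] /andP[? ?]; apply/andP; split; lra.
Qed.

Lemma homogeneous_pair (R : realType) (V W : finType) (f : V -> W -> R)
    (delta eta gam : R) (X : {set V}) (Y : {set W}) :
    X != set0 -> Y != set0 -> 0 <= gam -> 3 * eta <= delta ->
    concentrated f eta gam X -> concentrated (fun b a => f a b) eta gam Y ->
  homogeneous f delta (2 * gam) X Y.
Proof.
move=> X0 Y0 gam0 le_eta cX cY.
have widen (T : finType) (A B C : {set T}) (c : R) :
    2 * gam >= c -> B \subset C -> (1 - c) * #|A|%:R <= #|B|%:R ->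
    (1 - 2 * gam) * counting_prob R A <= counting_prob R C.
  move=> lec sBC leB; rewrite /counting_prob mulrA.
  rewrite ler_wpM2r ?invr_ge0 ?ler0n //.
  apply: le_trans (_ : #|B|%:R <= _); last by rewrite ler_nat subset_leq_card.
  by apply: le_trans leB; rewrite ler_wpM2r ?ler0n // lerD2l lerN2.
have gam2 : gam <= 2 * gam by lra.
have sub_approx (T : finType) (A : {set T}) (h : T -> R) (r : R) :
    [set x in A | approx (3 * eta) (h x) r] \subset
    [set x in A | approx delta (h x) r].
  apply/subsetP=> x; rewrite !inE => /andP[-> /=].
  by move/le_trans; apply.
have [Y' [sY' leY'] [r r01 rP]] := concentrated_pair X0 cX cY.
have [X' [sX' leX'] [s s01 sP]] := concentrated_pair Y0 cY cX.
exists X', Y'; split.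
- by split=> //; apply: widen leX'.
- by split=> //; apply: widen leY'.
- by exists r => // b /rP; apply: widen.
- by exists s => // a /sP; apply: widen.
Qed.

Lemma stable_flip (R : realType) (V W : Type) k (delta : R) (f : V -> W -> R) :
  stable k delta f -> stable k delta (fun b a => f a b).
Proof.
move=> st [b [a far]]; apply: st; exists a, b => i j ltij.
by rewrite distrC; apply: far.
Qed.

(** * Choice of parameters and assembly *)

Theorem theorem5p1 (R : realType) (k : nat) (hk : (1 <= k)%N)
    (delta : R) (hdelta : 0 < delta) (epsilon : R) (hepsilon : 0 < epsilon)
    (sigma : nat -> R) (hsigma : forall n, 0 < sigma n < 1) :
  exists N : nat,
    forall (V W : finType), (0 < #|V|)%N -> (0 < #|W|)%N ->
    forall f : V -> W -> R,
      (forall v w, 0 <= f v w <= 1) ->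
      stable k delta f ->
      exists (m n : nat) (Vp : nat -> {set V}) (Wp : nat -> {set W}),
        [/\ (1 <= m <= N)%N /\ (1 <= n <= N)%N,
            partition_upto m Vp /\ partition_upto n Wp,
            forall i j, (1 <= i <= m)%N -> (1 <= j <= n)%N ->
              homogeneous f (5 * delta + epsilon) (sigma (m * n)%N)
                (Vp i) (Wp j) &
            #|Vp 0%N|%:R <= epsilon * #|Vp 1%N|%:R /\
            #|Wp 0%N|%:R <= epsilon * #|Wp 1%N|%:R].
Proof.
(* The last threshold, with index [L.-1], reaches 1. *)
pose L := (Num.truncn delta^-1).+2.
have L1 : 1 <= L.-1%:R * delta.
  by rewrite -ler_pdivrMr // div1r ltW // truncnS_gt.
(* The accuracy doubles twice: in [unsplittable_concentrated] and in [homogeneous_pair]. *)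
pose gW m n := sigma (m * n)%N / 4.
have gW0 m n : 0 < gW m n by rewrite divr_gt0 //; case/andP: (hsigma (m * n)%N).
have gW_lt1 m n : 0 < gW m n < 1.
  by rewrite gW0 /gW; case/andP: (hsigma (m * n)%N) => _; lra.
have L0 : (0 < L)%N by [].
have [MW decW] :=
  choice (fun m => stable_partition L0 k hdelta hepsilon (gW0 m)).
(* The number of parts of W is only bounded in terms of that of V, so the parts
   of V are chosen to be fine enough for all its possible values. *)
have [MV decV] := stable_partition L0 k hdelta hepsilon
  (fun m => low_gt0 (MW m) (gW0 m)).
exists (maxn MV (\max_(m < MV.+1) MW m)) => V W V0 W0 f f01 st.
have [X0 [X1 [s [sV le_s leX0 us]]]] := decV V W f V0 st.
have [Y0 [Y1 [t [sW le_t leY0 ut]]]] :=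
  decW (size s).+1 W V _ W0 (stable_flip st).
exists (size s).+1, (size t).+1.
exists (nth set0 (X0 :: X1 :: s)), (nth set0 (Y0 :: Y1 :: t)).
split=> //.
- split; first by rewrite /= leq_max le_s.
  rewrite /= (leq_trans le_t) // leq_max; apply/orP; right.
  exact: leq_bigmax_ord.
- split; first by apply: splits_partition (X1 :: s) sV _ => P /us[].
  by apply: splits_partition (Y1 :: t) sW _ => P /ut[].
move=> [//|i] [//|j] lei lej.
have [Xi0 uXi] := us _ (mem_nth set0 (lei : (i < size (X1 :: s))%N)).
have [Yj0 uYj] := ut _ (mem_nth set0 (lej : (j < size (Y1 :: t))%N)).
set m := (size s).+1; set n := (size t).+1.
have -> : sigma (m * n)%N = 2 * (2 * gW m n) by rewrite /gW; lra.
(* The resulting closeness [3 * eta] is [9 / 2 * delta], below [5 * delta + epsilon]. *)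
apply: (homogeneous_pair (eta := 3 / 2 * delta)) => //.
- by rewrite mulr_ge0 // ltW.
- by lra.
- apply: unsplittable_concentrated L1 _ _ _ => //.
  by apply: unsplittable_le uXi; apply: (low_le (gW m)).
- by apply: unsplittable_concentrated L1 _ _ _.
Qed.
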